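(* Let $\alpha\in(0,1)$ be irrational and $z_{-1}\in\mathbb{C}$. If $$\left|z_{-1}-\frac{1}{1-e^{2\pi i\alpha}}\right|<\frac12,$$ then the greedy sequence with parameters $(\alpha,z_{-1})$ always picks sign $-1$ (that is, it is defined for all $n\ge0$ and $\varepsilon_n=-1$ for all $n\ge 0$), and it ends up in a circle (there are a circle in $\mathbb{C}$ and an $N$ such that $z_n$ lies on this circle for all $n\ge N$). Likewise, if $$\left|z_{-1}-\frac{1}{e^{2\pi i\alpha}-1}\right|<\frac12,$$ then the sequence always picks sign $+1$ (it is defined for all $n\ge 0$ and $\varepsilon_n=+1$ for all $n\ge0$).
   Context: Greedy sequence with parameters $(\alpha,z_{-1})$, where $\alpha>0$ is irrational and $z_{-1}\in\mathbb{C}$: for $n\ge 0$, $z_n=z_{n-1}+\varepsilon_n e^{2\pi i\alpha n}$ where the sign $\varepsilon_n\in\{-1,1\}$ is chosen so as to minimize $|z_n|$. If $|z_{n-1}+e^{2\pi i\alpha n}|=|z_{n-1}-e^{2\pi i\alpha n}|$ for some $n$, the sequence terminates at $z_{n-1}$ (neither $z_n$ nor $\varepsilon_n$, nor any later term, is defined). *)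

(* Defs.v *)
From Stdlib Require Import Reals QArith Qreals.
From Coquelicot Require Import Coquelicot.
Open Scope R_scope.

Definition irrational (x : R) : Prop := ~ exists q : Q, x = Q2R q.

(* [cis t] is e^(i t) for real t. *)
Definition cis (t : R) : C := (cos t, sin t).

(* The sign s in {-1, 1} minimizing |z + s w|; [None] when the two moduli are equal. *)
Definition greedy_choice (z w : C) : option R :=
  match total_order_T (Cmod (z + w)) (Cmod (z - w)) with
  | inleft (left _) => Some 1
  | inleft (right _) => None
  | inright _ => Some (-1)
  end.

(* [greedy_prev alpha z n] is z_(n-1), so that index 0 holds the initial value z_(-1);
   it is [None] once the sequence has terminated. *)
Fixpoint greedy_prev (alpha : R) (z : C) (n : nat) : option C :=
  match n with
  | O => Some z
  | S m =>
      match greedy_prev alpha z m with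
      | None => None
      | Some y =>
          let w := cis (2 * PI * alpha * INR m) in
          match greedy_choice y w with
          | None => None
          | Some s => Some (y + RtoC s * w)%C
          end
      end
  end.

(* z_n for n >= 0 *)
Definition greedy_term (alpha : R) (z : C) (n : nat) : option C :=
  greedy_prev alpha z (S n).

(* epsilon_n for n >= 0 *)
Definition greedy_sign (alpha : R) (z : C) (n : nat) : option R :=
  match greedy_prev alpha z n with
  | None => None
  | Some y => greedy_choice y (cis (2 * PI * alpha * INR n))
  end.

Definition always_picks (alpha : R) (z : C) (s : R) : Prop :=
  forall n : nat,
    (exists y : C, greedy_term alpha z n = Some y) /\ greedy_sign alpha z n = Some s.

Definition ends_up_in_circle (alpha : R) (z : C) : Prop :=
  exists (c : C) (r : R) (N : nat), 0 < r /\
    forall n : nat, (N <= n)%nat ->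
      exists y : C, greedy_term alpha z n = Some y /\ Cmod (y - c) = r.

(* Main.v *)
Require Import Defs.
From Stdlib Require Import Reals Lra.
From Coquelicot Require Import Coquelicot.
Open Scope R_scope.

(** Put [w = cis (2 * PI * alpha)], [c = 1 / (1 - w)], and let [s] be [1] or [-1].
    A sequence that takes the sign [s] at every step is a geometric sum, which closes up to
    [z_(n-1) = d - s w^n c] with the constant [d = z + s c]: it runs along the circle of
    centre [d] and radius [|c|].

    It remains to see that the greedy rule really takes [s] at each of these points. The
    rule selects the sign opposite to that of the real inner product of [z_(n-1)] with
    [w^n] (lemma [greedy_choice_inner]), and since [Re c = 1/2] (lemma
    [half_re_inv_1_minus_unit]) this product equals [<d, w^n> - s/2]. By Cauchy-Schwarz
    the condition [|d| < 1/2] makes the term [-s/2] dominant at every step, so that the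
    choice is always [s] and there is never a tie. The two claims are the cases [s = -1] and
    [s = 1] of lemma [greedy_prev_closed_form]. *)

Definition inner (z w : C) : R := fst z * fst w + snd z * snd w.

Lemma Cmod_sqr (z : C) : Cmod z ^ 2 = inner z z.
Proof.
  unfold Cmod, inner. rewrite pow2_sqrt; nra.
Qed.

(** Cauchy-Schwarz, from Lagrange's identity. *)
Lemma inner_le_Cmod (z w : C) : Rabs (inner z w) <= Cmod z * Cmod w.
Proof.
  assert (Hz := Cmod_ge_0 z). assert (Hw := Cmod_ge_0 w).
  rewrite <- (Rabs_pos_eq (Cmod z * Cmod w)) by nra.
  apply Rsqr_le_abs_0.
  replace (Rsqr (Cmod z * Cmod w)) with (inner z z * inner w w)
    by (rewrite <- !Cmod_sqr; unfold Rsqr; ring).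
  unfold Rsqr, inner.
  assert (H := Rle_0_sqr (fst z * snd w - snd z * fst w)). unfold Rsqr in H. nra.
Qed.

Lemma inner_cis (t : R) : inner (cis t) (cis t) = 1.
Proof.
  unfold inner, cis; simpl. assert (H := sin2_cos2 t). unfold Rsqr in H. lra.
Qed.

Lemma Cmod_cis (t : R) : Cmod (cis t) = 1.
Proof.
  assert (H := Cmod_sqr (cis t)). rewrite inner_cis in H.
  assert (H0 := Cmod_ge_0 (cis t)). nra.
Qed.

Lemma cis_plus (s t : R) : cis (s + t) = (cis s * cis t)%C.
Proof.
  unfold cis, Cmult; simpl. rewrite cos_plus, sin_plus. f_equal; ring.
Qed.

Lemma cis_neq_1 (alpha : R) : 0 < alpha < 1 -> cis (2 * PI * alpha) <> RtoC 1.
Proof.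
  intros Ha H. injection H as Hcos _.
  replace (2 * PI * alpha) with (2 * (PI * alpha)) in Hcos by ring.
  rewrite cos_2a_sin in Hcos.
  assert (HPI := PI_RGT_0).
  assert (Hs : 0 < sin (PI * alpha)) by (apply sin_gt_0; nra).
  nra.
Qed.

(** The Moebius map [w |-> 1 / (1 - w)] has its pole at [1], on the unit circle, and so
    carries the circle to a line: the line [Re = 1/2]. *)
Lemma half_re_inv_1_minus_unit (w c : C) :
  inner w w = 1 -> w <> RtoC 1 -> (c * (1 - w) = 1)%C -> fst c = 1 / 2.
Proof.
  destruct w as [a b], c as [x y]; unfold inner; simpl.
  intros Hw Hne Hc.
  unfold Cmult, Cminus, Cplus, Copp, RtoC in Hc; simpl in Hc.
  injection Hc as H1 H2.
  assert (Ha : 1 - a <> 0).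
  { intro Ha. apply Hne. unfold RtoC. f_equal; nra. }
  apply (Rmult_eq_reg_l (1 - a)); [|exact Ha].
  (* Real part of [c (1 - w) = 1] times the conjugate of [1 - w];
     then [|1 - w|^2 = 2 (1 - a)], as [|w| = 1]. *)
  assert (Hx : x * ((1 - a) ^ 2 + b ^ 2) = 1 - a).
  { transitivity ((1 - a) * (x * (1 + - a) - y * (0 + - b))
                  - b * (x * (0 + - b) + y * (1 + - a))); [ring|].
    rewrite H1, H2. ring. }
  replace ((1 - a) ^ 2 + b ^ 2) with (2 * (1 - a)) in Hx by lra.
  lra.
Qed.

(** By polarization, [|z + w|^2 - |z - w|^2 = 4 <z, w>]. *)
Lemma greedy_choice_inner (z w : C) (s : R) :
  s = 1 \/ s = -1 -> s * inner z w < 0 -> greedy_choice z w = Some s.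
Proof.
  intros Hs H.
  assert (Hpol : Cmod (z + w) ^ 2 - Cmod (z - w) ^ 2 = 4 * inner z w).
  { rewrite !Cmod_sqr. unfold inner; simpl. ring. }
  assert (Hp := Cmod_ge_0 (z + w)). assert (Hm := Cmod_ge_0 (z - w)).
  unfold greedy_choice.
  destruct total_order_T as [[Hlt | Heq] | Hgt].
  - destruct Hs as [-> | ->]; [reflexivity | nra].
  - rewrite Heq in Hpol. nra.
  - destruct Hs as [-> | ->]; [nra | reflexivity].
Qed.

(** Rotating back by [w] shows that [<w c, w> = Re c]: the moving part of the point
    contributes the constant [- s / 2] to the inner product, wherever it is on its circle,
    and the part [d] contributes less than [1/2] in absolute value. *)
Lemma greedy_choice_on_circle (d w c : C) (s : R) :
  s = 1 \/ s = -1 -> inner w w = 1 -> Cmod d < 1 / 2 -> fst c = 1 / 2 ->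
  greedy_choice (d - s * w * c)%C w = Some s.
Proof.
  intros Hs Hw Hd Hc. apply greedy_choice_inner; [exact Hs|].
  assert (Hinner : inner (d - s * w * c)%C w = inner d w - s * fst c * inner w w).
  { unfold inner; simpl. ring. }
  rewrite Hinner, Hw, Hc.
  assert (Hw1 : Cmod w = 1).
  { assert (H := Cmod_sqr w). assert (H0 := Cmod_ge_0 w). nra. }
  assert (HCS := inner_le_Cmod d w). rewrite Hw1 in HCS.
  apply Rabs_le_between in HCS.
  destruct Hs as [-> | ->]; lra.
Qed.

Section ConstantSign.

Variables (alpha s : R) (z c : C).
Let w := cis (2 * PI * alpha).
Let d := (z + s * c)%C.

Hypothesis s_sign : s = 1 \/ s = -1.
Hypothesis alpha_bounds : 0 < alpha < 1.
Hypothesis c_inv : (c * (1 - w) = 1)%C.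
Hypothesis d_small : Cmod d < 1 / 2.

Lemma greedy_choice_closed_form (n : nat) :
  let wn := cis (2 * PI * alpha * INR n) in
  greedy_choice (d - s * wn * c)%C wn = Some s.
Proof.
  apply greedy_choice_on_circle; try assumption.
  - apply inner_cis.
  - apply (half_re_inv_1_minus_unit w); try assumption.
    + apply inner_cis.
    + now apply cis_neq_1.
Qed.

(** Adding [s w^n] multiplies the moving part [s w^n c] by [w], because [c - 1 = w c]. *)
Lemma greedy_prev_closed_form (n : nat) :
  greedy_prev alpha z n = Some (d - s * cis (2 * PI * alpha * INR n) * c)%C.
Proof.
  induction n as [|n IH].
  - simpl. rewrite Rmult_0_r. unfold cis. rewrite cos_0, sin_0.
    change (1, 0) with (RtoC 1). unfold d. f_equal. ring.
  - cbn [greedy_prev]. rewrite IH. cbv zeta.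
    rewrite greedy_choice_closed_form. f_equal.
    rewrite S_INR, Rmult_plus_distr_l, Rmult_1_r, cis_plus. fold w.
    set (v := cis (2 * PI * alpha * INR n)).
    transitivity (d - s * v * c + s * v * (c * (1 - w)))%C;
      [rewrite c_inv|]; ring.
Qed.

Lemma always_picks_constant_sign : always_picks alpha z s.
Proof.
  intro n. split.
  - unfold greedy_term. rewrite greedy_prev_closed_form. eexists; reflexivity.
  - unfold greedy_sign. rewrite greedy_prev_closed_form.
    apply greedy_choice_closed_form.
Qed.

Lemma ends_up_in_circle_constant_sign : ends_up_in_circle alpha z.
Proof.
  exists d, (Cmod c), 0%nat. split.
  - apply Cmod_gt_0. intro Hc0. rewrite Hc0, Cmult_0_l in c_inv.
    apply RtoC_inj in c_inv. lra.
  - intros n _. unfold greedy_term. rewrite greedy_prev_closed_form.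
    eexists; split; [reflexivity|].
    set (v := 2 * PI * alpha * INR (S n)).
    replace (d - s * cis v * c - d)%C with (- (s * cis v * c))%C by ring.
    rewrite Cmod_opp, !Cmod_mult, Cmod_cis, Cmod_R.
    destruct s_sign as [-> | ->]; [rewrite Rabs_R1 | rewrite Rabs_m1]; ring.
Qed.

End ConstantSign.

Theorem proposition3 (alpha : R) (z : C)
  (alpha_bounds : 0 < alpha < 1) (alpha_irr : irrational alpha) :
  (Cmod (z - 1 / (1 - cis (2 * PI * alpha)))%C < 1 / 2 ->
     always_picks alpha z (-1) /\ ends_up_in_circle alpha z) /\
  (Cmod (z - 1 / (cis (2 * PI * alpha) - 1))%C < 1 / 2 ->
     always_picks alpha z 1).
Proof.
  set (w := cis (2 * PI * alpha)).
  assert (Hw : (1 - w <> 0)%C).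
  { intro H. apply (cis_neq_1 alpha alpha_bounds). fold w.
    replace w with (1 - (1 - w))%C by ring. rewrite H. ring. }
  assert (Hinv : (1 / (1 - w) * (1 - w) = 1)%C) by (field; exact Hw).
  split; intro Hz.
  - assert (Hd : Cmod (z + RtoC (-1) * (1 / (1 - w)))%C < 1 / 2).
    { replace (z + RtoC (-1) * (1 / (1 - w)))%C with (z - 1 / (1 - w))%C; [exact Hz|].
      change (RtoC (-1)) with (RtoC (- (1))). rewrite RtoC_opp. field. exact Hw. }
    split.
    + apply (always_picks_constant_sign alpha (-1) z (1 / (1 - w))%C); auto.
    + apply (ends_up_in_circle_constant_sign alpha (-1) z (1 / (1 - w))%C); auto.
  - apply (always_picks_constant_sign alpha 1 z (1 / (1 - w))%C); auto.
    replace (z + RtoC 1 * (1 / (1 - w)))%C with (z - 1 / (w - 1))%C; [exact Hz|].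
    field. split; [exact Hw|].
    intro H. apply Hw. replace (1 - w)%C with (- (w - 1))%C by ring. rewrite H. ring.
Qed.
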